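(* Let $n_1,n_2,m$ be positive integers, let $Z\subseteq\{0,1\}^{n_1+n_2}$ be non-empty, and let $f:\operatorname{conv}(Z)\times\mathbb{R}^m\to\mathbb{R}$ be a function such that $f(x,y,\cdot)$ is concave on $\mathbb{R}^m$ for each $(x,y)\in Z$. Let $X=\{x\in\{0,1\}^{n_1} \mid \exists\, y\in\{0,1\}^{n_2}: (x,y)\in Z\}$ and, for $x\in X$, let $Y(x)=\{y\in\{0,1\}^{n_2}\mid (x,y)\in Z\}$. Then for every $U\subset\mathbb{R}^m$, \[ \max_{c\in U}\ \min_{(x,y)\in\operatorname{conv}(Z)} f(x,y,c) \] is a lower bound for the optimal value of the binary two-stage robust problem \[ \min_{x\in X}\ \max_{c\in U}\ \min_{y\in Y(x)} f(x,y,c), \] that is, \[ \max_{c\in U}\ \min_{(x,y)\in\operatorname{conv}(Z)} f(x,y,c)\ \le\ \min_{x\in X}\ \max_{c\in U}\ \min_{y\in Y(x)} f(x,y,c). \]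
   Context: Vectors in $\mathbb{R}^{n_1+n_2}$ are written as pairs $(x,y)$ with $x\in\mathbb{R}^{n_1}$ (first-stage variables) and $y\in\mathbb{R}^{n_2}$ (second-stage variables). $\operatorname{conv}(Z)$ denotes the convex hull of $Z$ in $\mathbb{R}^{n_1+n_2}$. The set $Z$ is the set of incidence vectors of feasible solutions of the underlying deterministic problem $\min_{(x,y)\in Z} f(x,y,c)$, and $U$ is the uncertainty set of possible parameter vectors $c$. Maxima and minima are understood as suprema and infima in $[-\infty,+\infty]$ whenever they are not attained. *)

(* Defs.v *)
From mathcomp Require Import all_boot all_order all_algebra.
From mathcomp Require Import interval_inference classical_sets reals topology convex.

Set Implicit Arguments.
Unset Strict Implicit.
Unset Printing Implicit Defensive.

Import GRing.Theory Num.Theory.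
Local Open Scope classical_set_scope.
Local Open Scope ring_scope.
Local Open Scope convex_scope.

Definition conv_hull (R : numDomainType) (E : lmodType R) (A : set E) : set E :=
  smallest (@convex_set R E) A.

(* [convex_function] with the inequality reversed. *)
Definition concave_function (R : numFieldType) (E : lmodType R)
    (E' := convex_lmodType E) (D : set E') (f : E' -> R^o) : Prop :=
  forall t : {i01 R},
    {in D &, forall x y : E', f x <| t |> f y <= f (x <| t |> y)}.

Definition binary_vectors (R : numDomainType) (n : nat) : set 'rV[R]_n :=
  [set v : 'rV[R]_n | forall i, v ord0 i = 0 \/ v ord0 i = 1].
Arguments binary_vectors : clear implicits.

(* A pair (x, y) with x in R^n1 and y in R^n2 is the vector [row_mx x y] of
   R^(n1 + n2). *)
Definition first_stage (R : numDomainType) (n1 n2 : nat)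
    (Z : set 'rV[R]_(n1 + n2)) : set 'rV[R]_n1 :=
  [set x : 'rV[R]_n1 | binary_vectors R n1 x /\
           exists y, binary_vectors R n2 y /\ Z (row_mx x y)].

Definition second_stage (R : numDomainType) (n1 n2 : nat)
    (Z : set 'rV[R]_(n1 + n2)) (x : 'rV[R]_n1) : set 'rV[R]_n2 :=
  [set y : 'rV[R]_n2 | binary_vectors R n2 y /\ Z (row_mx x y)].

(* Main.v *)
Require Import Defs.
From mathcomp Require Import all_boot all_order all_algebra.
From mathcomp Require Import classical_sets reals constructive_ereal ereal.

(** The bound is a relaxation argument. For fixed [x] and each scenario [c], the
    points [(x, y)] with [y] feasible for [x] lie in [Z], hence in its convex
    hull, so the inner minimum over the hull is at most the second-stage minimum
    over [y]. Monotonicity of the supremum over [c] and the definition of the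
    infimum over [x] then give the inequality. *)

Import Order.TTheory.

Local Open Scope classical_set_scope.
Local Open Scope ring_scope.

(* [f] is total, but only its values on [conv_hull Z] occur below. *)
Theorem lemma2p1 (R : realType) (n1 n2 m : nat)
    (n1_gt0 : (0 < n1)%N) (n2_gt0 : (0 < n2)%N) (m_gt0 : (0 < m)%N)
    (Z : set 'rV[R]_(n1 + n2)) (Zbin : Z `<=` binary_vectors R (n1 + n2))
    (Zneq0 : Z !=set0)
    (f : 'rV[R]_(n1 + n2) -> 'rV[R]_m -> R)
    (fconcave : forall z, Z z -> concave_function [set: 'rV[R]_m] (f z))
    (U : set 'rV[R]_m) :
  (ereal_sup [set ereal_inf [set (f z c)%:E | z in conv_hull Z] | c in U]
   <= ereal_inf
        [set ereal_sup
          [set ereal_inf [set (f (row_mx x y) c)%:E | y in second_stage Z x]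
          | c in U]
        | x in first_stage Z])%E.
Proof.
apply: le_ereal_inf_tmp => _ [x _ <-].
apply: ge_ereal_sup => _ [c Uc <-].
apply: (@le_trans _ _
  (ereal_inf [set (f (row_mx x y) c)%:E | y in second_stage Z x])).
- apply: ereal_inf_le_tmp => _ [y [_ Zxy] <-].
  exists (row_mx x y) => //.
  exact: sub_gen_smallest.
- by apply: ereal_sup_ubound; exists c.
Qed.
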